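(* Let $f\in\Gamma_0(X)$ be translation-invariant with respect to $\operatorname{Fix}R$ and such that $Y\cap\operatorname{dom}f^*\neq\varnothing$, where $Y=(\operatorname{Fix}R)^\perp$. Let $d=d_f\in Y$ be the vector defined in the context. Then the following statements are equivalent for every $z\in X$: (i) $z=\operatorname{Prox}_f Rz$. (ii) $f^*(Sz)+f(z)+\frac12\|Sz\|^2=0$. (iii) $Sz=d$.
   Context: $X$ is a real Hilbert space with inner product $\langle\cdot,\cdot\rangle$ and norm $\|\cdot\|$. $m\in\{1,2,\dots\}$ and $R:X\to X$ is a linear isometry with $R^m=\mathrm{Id}$. $\operatorname{Fix}R=\{x: Rx=x\}$, $Y=(\operatorname{Fix}R)^\perp$, $S=R-\mathrm{Id}$, $Q=\frac1m\sum_{i=1}^{m-1}iR^i$. $\Gamma_0(X)$ is the set of proper lower semicontinuous convex functions $X\to\,]-\infty,+\infty]$. $f^*(x^* )=\sup_{x\in X}(\langle x,x^*\rangle-f(x))$ is the Fenchel conjugate; $\operatorname{dom}f=\{f<+\infty\}$; $\partial f$ is the convex subdifferential; $\operatorname{Prox}_f=(\mathrm{Id}+\partial f)^{-1}$ is the (single-valued) proximal mapping of $f\in\Gamma_0(X)$. $f:X\to\,]-\infty,+\infty]$ is translation-invariant with respect to a subset $C$ of $X$ if $f(x+c)=f(x)$ for all $x\in X$, $c\in C$. The vector $d_f$: for $f\in\Gamma_0(X)$ with $Y\cap\operatorname{dom}f^*\ne\varnothing$, there is a unique pair $(e,d)\in Y\times Y$ such that $d=Se\in\operatorname{dom}f^*$,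 $e=Qd$, and $f^*(Se)+\langle y-Se,e\rangle-f^*(y)\le0$ for all $y\in Y$; it is denoted $(e_f,d_f)$. *)

(* Defs.v *)
From mathcomp Require Import all_boot all_order all_algebra.
From mathcomp Require Import all_classical all_reals all_analysis.
Import Order.TTheory GRing.Theory Num.Theory.
Import numFieldNormedType.Exports.

Set Implicit Arguments.
Unset Strict Implicit.
Unset Printing Implicit Defensive.

Local Open Scope classical_set_scope.
Local Open Scope ring_scope.

(* A real Hilbert space is a complete normed module X over the reals K with a
   dot product ip inducing its norm. *)
Definition induces_norm (K : realType) (X : normedModType K)
    (ip : {dot X for idfun}) : Prop :=
  forall x, ip x x = `|x| ^+ 2.

Section Operators.
Context {K : realType} {X : completeNormedModType K}.
Implicit Types (ip : {dot X for idfun}) (R : {linear X -> X}) (C : set X).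

Definition norm_isometry R : Prop := forall x, `|R x| = `|x|.

Definition fixset_of R : set X := [set x | R x = x].

Definition orthocomp ip C : set X := [set y | forall x, C x -> ip x y = 0].

Definition displ R (x : X) : X := R x - x.

Definition Qop (m : nat) R (x : X) : X :=
  m%:R^-1 *: \sum_(1 <= i < m) i%:R *: iter i R x.

End Operators.

Section ConvexAnalysis.
Context {K : realType} {X : completeNormedModType K}.
Implicit Types (ip : {dot X for idfun}) (R : {linear X -> X}).
Implicit Types (f : X -> \bar K) (C : set X).
Local Open Scope ereal_scope.

Definition edom f : set X := [set x | f x < +oo].

Definition eproper f : Prop :=
  (forall x, -oo < f x) /\ edom f !=set0.

(* For functions avoiding -oo, so that no sum +oo - oo arises on the right. *)
Definition econvex f : Prop :=
  forall (x y : X) (t : K), (0 < t)%R -> (t < 1)%R ->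
    f (t *: x + (1 - t) *: y)%R <= t%:E * f x + (1 - t)%:E * f y.

Definition Gamma0 : set (X -> \bar K) :=
  [set f | [/\ eproper f, lower_semicontinuous f & econvex f]].

Definition conjugate ip f (u : X) : \bar K :=
  ereal_sup [set (ip x u)%:E - f x | x in [set: X]].

Definition translation_invariant f C : Prop :=
  forall x c, C c -> f (x + c)%R = f x.

Definition subdifferential ip f (x : X) : set X :=
  [set u | forall y, (ip (y - x)%R u)%:E + f x <= f y].

(* The inverse of the set-valued operator Id + subdifferential: its value at x
   is a set, which is a singleton for f in Gamma0.  The equation
   z = Prox_f x thus reads Prox ip f x = [set z]. *)
Definition Prox ip f (x : X) : set X :=
  [set p | exists2 u, subdifferential ip f p u & x = (p + u)%R].

(* (e, d) satisfies the conditions that characterize the pair (e_f, d_f). *)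
Record is_ed_pair ip (m : nat) R f (e d : X) : Prop := IsEdPair {
  ed_eY : orthocomp ip (fixset_of R) e;
  ed_dY : orthocomp ip (fixset_of R) d;
  ed_dS : d = displ R e;
  ed_ddom : edom (conjugate ip f) d;
  ed_eQ : e = Qop m R d;
  ed_le0 : forall y, orthocomp ip (fixset_of R) y ->
    conjugate ip f (displ R e) + (ip (y - displ R e)%R e)%:E
      - conjugate ip f y <= 0
}.

End ConvexAnalysis.

(* Main.v *)
Require Import Defs.
From mathcomp Require Import all_boot all_order all_algebra.
From mathcomp Require Import all_classical all_reals all_analysis.
From mathcomp Require Import lra.
Import Order.TTheory GRing.Theory Num.Theory.
Import numFieldNormedType.Exports.

Set Implicit Arguments.
Unset Strict Implicit.
Unset Printing Implicit Defensive.

Local Open Scope classical_set_scope.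
Local Open Scope ring_scope.

(** Write S for the displacement operator R - Id.  Both (i) and (ii) say that
    S z is a subgradient of f at z: (i) because z = Prox_f (R z) means
    R z - z is such a subgradient, and (ii) because it is the equality case of
    the Fenchel-Young inequality, once one knows that
    <w, S w> = - |S w|^2 / 2 for every w, R being an isometry
    ([Prox_set1P], [subdifferentialP], [ip_displ]).

    Let Y be the orthogonal complement of Fix R.  Translation invariance
    forces dom f^* into Y ([edom_conjugate_orthocomp]), so the inequality that
    characterizes (e, d), given on Y only, says that e is a subgradient of f^*
    at d.
    If S z is a subgradient of f at z, then z is a subgradient of f^* at S z,
    and monotonicity of the subdifferential of f^* gives
    0 <= <S z - d, z - e> = <S (z - e), z - e> = - |S (z - e)|^2 / 2,
    so that S z = S e = d.

    Conversely, let S z = d = S e.  Then z - e is fixed by R and d is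
    orthogonal to Fix R, so it suffices that d be a subgradient of f at e
    ([subdifferential_translation]).  This is the one place where the
    completeness of X and the lower semicontinuity of f are used: it is a case
    of the Fenchel-Moreau theorem, here derived from the existence of the
    proximal point p of e + d ([subdifferential_unconjugate]).  Indeed, p is a
    subgradient of f^* at u = e + d - p, so monotonicity gives
    0 <= <u - d, p - e> = - |p - e|^2, whence p = e and u = d.  The proximal
    point is the limit of a minimizing sequence ([minimizer_ex]). *)

(** * Bilinearity of the inner product *)

Section InnerProduct.
Context {K : realType} {X : completeNormedModType K} (ip : {dot X for idfun}).
Implicit Types (x y z u : X) (t : K).

Lemma ipC x y : ip x y = ip y x.
Proof. by rewrite hermC /= expr0 mul1r. Qed.

Lemma ipDl x y z : ip (x + y) z = ip x z + ip y z.
Proof. exact: linearDl. Qed.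

Lemma ipZl t x z : ip (t *: x) z = t * ip x z.
Proof. exact: linearZl_LR. Qed.

Lemma ipNl x z : ip (- x) z = - ip x z.
Proof. exact: linearNl. Qed.

Lemma ipDr x y z : ip z (x + y) = ip z x + ip z y.
Proof. exact: linearD. Qed.

Lemma ipZr t x z : ip z (t *: x) = t * ip z x.
Proof. by rewrite ipC ipZl ipC. Qed.

Lemma ipNr x z : ip z (- x) = - ip z x.
Proof. exact: linearN. Qed.

Definition ipE := (ipDl, ipDr, ipNl, ipNr, ipZl, ipZr).

Hypothesis ip_norm : induces_norm ip.

Lemma ip_ge0 x : 0 <= ip x x.
Proof. by rewrite ip_norm exprn_ge0. Qed.

Lemma ip_le0_eq0 x : ip x x <= 0 -> x = 0.
Proof.
move=> h; apply/eqP; rewrite -normr_eq0 -sqrf_eq0 -ip_norm.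
by rewrite eq_le h ip_ge0.
Qed.

End InnerProduct.

(** * Minimization of strongly convex functions *)

Section Minimization.
Context {K : realType} {X : completeNormedModType K}.
Local Open Scope ereal_scope.
Implicit Types (F : X -> \bar K).

Lemma EFin_lt_between (r : K) (y : \bar K) :
  r%:E < y -> exists2 s, (r < s)%R & s%:E < y.
Proof.
case: y => [y| |]//; last by exists (r + 1)%R; rewrite ?ltry//; lra.
by rewrite lte_fin => ry; exists ((r + y) / 2)%R; rewrite ?lte_fin; lra.
Qed.

(** The last hypothesis is strong convexity at midpoints; real upper bounds
    r and s stand for the values of F, so that no infinite value has to be
    halved.  It makes every minimizing sequence Cauchy, since a midpoint
    cannot fall below the infimum. *)
Lemma minimizer_ex F (b : K) x0 :
    (forall x, b%:E <= F x) -> F x0 < +oo -> lower_semicontinuous F ->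
    (forall x y (r s : K), F x <= r%:E -> F y <= s%:E ->
       F (2^-1 *: (x + y))%R + (8^-1 * `|x - y| ^+ 2)%:E <= ((r + s) / 2)%:E) ->
  exists2 p, F p < +oo & forall x, F p <= F x.
Proof.
move=> Fb Fx0 Flsc Fmid.
pose I := ereal_inf (range F).
have I_le x : I <= F x by apply: ereal_inf_lbound; exists x.
have bI : b%:E <= I by apply: le_ereal_inf_tmp => _ [x _ <-]; exact: Fb.
have Ifin : I \is a fin_num.
  by rewrite fin_numElt (lt_le_trans _ bI) ?ltNyr// (le_lt_trans (I_le x0)).
pose mu : K := fine I.
have Imu : I = mu%:E by rewrite fineK.
have mu_le x : mu%:E <= F x by rewrite -Imu.
have ex_near n : exists x, F x <= (mu + n.+1%:R^-1)%:E.
  have [|_ [x _ <-] hx] := @lb_ereal_inf_adherent _ (range F) (n.+1%:R^-1)%R _ Ifin.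
    by rewrite invr_gt0.
  by exists x; rewrite EFinD -Imu ltW.
pose v n := xchoose (ex_near n).
have vP n : F (v n) <= (mu + n.+1%:R^-1)%:E := xchooseP (ex_near n).
have v_dist i j : (`|v i - v j| ^+ 2 <= 4 * (i.+1%:R^-1 + j.+1%:R^-1))%R.
  have := le_trans (leeD2r _ (mu_le _)) (Fmid _ _ _ _ (vP i) (vP j)).
  rewrite -EFinD lee_fin; move: (_ ^+ 2)%R (i.+1%:R^-1)%R (j.+1%:R^-1)%R.
  by move=> D A B; lra.
have : cvg (v @ \oo).
  apply/cauchy_cvgP/cauchy_exP => eps eps0.
  have e8 : (0 < eps ^+ 2 / 8)%R by rewrite divr_gt0// exprn_gt0.
  have [N _ NP] := near_infty_natSinv_lt (PosNum e8).
  exists (v N); exists N => // n /= Nn.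
  rewrite -ball_normE /ball_ /=.
  rewrite -(ltr_pXn2r (ltn0Sn 1)) ?nnegrE ?normr_ge0 ?(ltW eps0)//.
  apply: le_lt_trans (v_dist _ _) _.
  have := NP n Nn; have := NP N (leqnn N) => /=.
  move: (eps ^+ 2)%R (n.+1%:R^-1)%R (N.+1%:R^-1)%R => E A B; lra.
move=> /cvg_ex[p vp].
suff Fp : F p <= mu%:E.
  exists p; first exact: le_lt_trans Fp (ltry _).
  by move=> x; exact: le_trans (mu_le x).
rewrite leNgt; apply/negP => /EFin_lt_between[r mur rF].
have [V Vp VF] := Flsc _ _ rF.
have rmu0 : (0 < r - mu)%R by rewrite subr_gt0.
have [n [nV nr]] : exists n, V (v n) /\ (n.+1%:R^-1 < r - mu)%R.
  have : \forall n \near \oo, V (v n) /\ (n.+1%:R^-1 < r - mu)%R.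
    near=> n; split; near: n; first exact: vp.
    exact: (near_infty_natSinv_lt (PosNum rmu0)).
  by move=> /filter_ex.
have := lt_le_trans (VF _ nV) (vP n).
by rewrite lte_fin ltNge -lerBrDl ltW.
Unshelve. all: end_near. Qed.

End Minimization.

(** * Subgradients, conjugates and proximal points *)

Section Subdifferential.
Context {K : realType} {X : completeNormedModType K} (ip : {dot X for idfun}).
Hypothesis ip_norm : induces_norm ip.
Local Open Scope ereal_scope.
Implicit Types (f : X -> \bar K) (x y p q u v a : X).

Lemma ip_sub_conjugate f x u : (ip x u)%:E - f x <= conjugate ip f u.
Proof. by apply: ereal_sup_ubound; exists x. Qed.

Lemma conjugate_gtNy f u : eproper f -> -oo < conjugate ip f u.
Proof.
move=> [fNy [x fx]]; apply: lt_le_trans (ip_sub_conjugate f x u).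
move: (fNy x) fx; rewrite /edom /=; case: (f x) => // r _ _.
by rewrite -EFinB ltNyr.
Qed.

(** A point u of the domain of the conjugate provides the affine minorant
    <., u> - f^*(u) of f; the quadratic term dominates it, so the objective is
    bounded below. *)
Lemma prox_minimizer_ex f u a : Gamma0 f -> edom (conjugate ip f) u ->
  exists2 p, f p < +oo & forall x,
    f p + (2^-1 * `|p - a| ^+ 2)%:E <= f x + (2^-1 * `|x - a| ^+ 2)%:E.
Proof.
move=> [[fNy [x0 fx0]] flsc fcvx] udom.
have fprop : eproper f by split => //; exists x0.
pose q x : K := (2^-1 * `|x - a| ^+ 2)%R.
have cE : conjugate ip f u = (fine (conjugate ip f u))%:E.
  by rewrite fineK// fin_numElt conjugate_gtNy.
set c := fine _ in cE.
have qcont : continuous q.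
  move=> x; apply: cvgM; first exact: cvg_cst.
  apply: (@cvg_comp _ _ _ _ (fun y : K => y ^+ 2)%R) (@exprn_continuous _ _ _).
  apply: cvg_norm; apply: cvgB; [exact: cvg_id|exact: cvg_cst].
have [p pdom pmin] : exists2 p, f p + (q p)%:E < +oo &
    forall x, f p + (q p)%:E <= f x + (q x)%:E.
  apply: (@minimizer_ex _ _ (fun x => f x + (q x)%:E)
            (ip a u - c - 2^-1 * `|u| ^+ 2) x0).
  - move=> x; have := ip_sub_conjugate f x u; rewrite cE.
    move: (fNy x); case: (f x) => [r| |]// _; last by rewrite addye// leey.
    rewrite -EFinB -EFinD !lee_fin /q => h; move: h.
    (* completing the square in x - a *)
    have := ip_ge0 ip_norm (x - a + u)%R; rewrite -!ip_norm !ipE.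
    by rewrite (ipC ip a x) (ipC ip u x) (ipC ip u a); lra.
  - by rewrite lte_add_pinfty ?ltry.
  - move=> x r rfq.
    (* split the strict inequality r < f x + q x into s < f x and r - s < q x *)
    have rf : (r - q x)%R%:E < f x.
      move: rfq; case: (f x) (fNy x) => [s| |]// _ => [|_]; last exact: ltry.
      by rewrite -EFinD !lte_fin ltrBlDr.
    have [s rs sf] := EFin_lt_between rf.
    have [V Vx Vf] := flsc _ _ sf.
    exists (V `&` [set y | r - s < q y]%R).
      apply: filterI => //; apply: (cvgr_gt (q x)); first exact: qcont.
      by lra.
    move=> y [/Vf sfy /= qy]; rewrite -lteBlDr// -EFinB.
    by apply: lt_trans sfy; rewrite lte_fin; lra.
  - move=> x y r s.
    have := fcvx x y (2^-1)%R ltac:(lra) ltac:(lra).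
    move: (fNy x) (fNy y).
    case: (f x) => // r' _; case: (f y) => // s' _.
    rewrite -!EFinM -!EFinD !lee_fin => fm fr fs.
    have -> : (2^-1 *: (x + y) = 2^-1 *: x + (1 - 2^-1) *: y)%R.
      by rewrite scalerDr; congr (_ + _ *: _)%R; lra.
    rewrite -addeA -EFinD.
    apply: le_trans (leeD2r _ fm) _.
    rewrite -EFinD lee_fin.
    move: fr fs; rewrite /q -!ip_norm !ipE.
    rewrite (ipC ip a x) (ipC ip y x) (ipC ip a y); lra.
exists p => //.
by move: pdom (fNy p); case: (f p).
Qed.

(** Comparing the minimizer with a point at parameter t on the segment towards
    y gives the subgradient inequality up to an error linear in t. *)
Lemma prox_minimizer_subdifferential f p a : Gamma0 f -> f p < +oo ->
    (forall x,
      f p + (2^-1 * `|p - a| ^+ 2)%:E <= f x + (2^-1 * `|x - a| ^+ 2)%:E) ->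
  subdifferential ip f p (a - p)%R.
Proof.
move=> [[fNy _] _ fcvx] fp pmin y.
move: (fNy p) (fNy y) fp.
case fpE : (f p) => [r| |] // _.
case fyE : (f y) => [s| |] // _ _; last exact: leey.
rewrite -EFinD lee_fin.
set W : K := (`|y - p| ^+ 2)%R; set D := (ip (y - p) (a - p) + r - s)%R.
have W0 : (0 <= W)%R by exact: exprn_ge0.
have Dle t : (0 < t -> t < 1 -> D <= 2^-1 * t * W)%R.
  move=> t0 t1; have := fcvx y p t t0 t1.
  rewrite fpE fyE -!EFinM -EFinD => ft.
  have := le_trans (pmin _) (leeD2r _ ft).
  rewrite fpE -!EFinD lee_fin => h.
  rewrite -(ler_pM2l t0); move: h; rewrite /W /D -!ip_norm !ipE.
  by rewrite (ipC ip p y) (ipC ip a y) (ipC ip a p); lra.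
suff : (D <= 0)%R by rewrite /D; lra.
rewrite leNgt; apply/negP => D0.
(* t = D / (D + W + 1) lies in ]0, 1[ and is so small that t * W < 2 * D *)
have S0 : (0 < D + W + 1)%R by lra.
have t0 : (0 < D / (D + W + 1))%R by rewrite divr_gt0.
have t1 : (D / (D + W + 1) < 1)%R by rewrite ltr_pdivrMr//; lra.
have := Dle _ t0 t1.
have tE : (D / (D + W + 1) * (D + W + 1) = D)%R by rewrite divfK// gt_eqF.
move: t0 t1 tE; set t := (D / _)%R => t0 t1 tE; nra.
Qed.

Lemma subdifferential_fin f x u : eproper f -> subdifferential ip f x u ->
  f x \is a fin_num.
Proof.
move=> [fNy [y fy]] /(_ y); move: (fNy x) fy; rewrite /edom /=.
by case: (f x) => // _; case: (f y).
Qed.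

Lemma conjugate_subdifferential f x u : eproper f ->
  subdifferential ip f x u -> conjugate ip f u = (ip x u)%:E - f x.
Proof.
move=> fprop xu; have xfin := subdifferential_fin fprop xu.
apply/eqP; rewrite eq_le ip_sub_conjugate andbT.
apply: ge_ereal_sup => _ [y _ <-]; have := xu y.
have [fNy _] := fprop; move: (fNy y) xfin.
case: (f x) => // r; case: (f y) => [s| |]// _ _; last by rewrite leNye.
by rewrite -!EFinD !lee_fin !ipE; lra.
Qed.

(** The equality case of the Fenchel-Young inequality. *)
Lemma subdifferentialP f x u : eproper f ->
  subdifferential ip f x u <-> conjugate ip f u + f x = (ip x u)%:E.
Proof.
move=> fprop; split => [xu|].
  rewrite (conjugate_subdifferential fprop xu) subeK//.
  exact: subdifferential_fin xu.
have [fNy _] := fprop.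
move=> h y; have := ip_sub_conjugate f y u.
move: (fNy y) (fNy x) (conjugate_gtNy u fprop) h.
case: (f y) => [s| |]//; last by move=> *; exact: leey.
case: (f x) => [r| |]//; case: (conjugate _ _ _) => [c| |]//.
rewrite -EFinB -!EFinD !lee_fin => _ _ _ [h]; move: h; rewrite !ipE; lra.
Qed.

Lemma subdifferential_conjugate f x u : eproper f ->
  subdifferential ip f x u -> subdifferential ip (conjugate ip f) u x.
Proof.
move=> fprop xu y; have := ip_sub_conjugate f x y.
rewrite (conjugate_subdifferential fprop xu); apply: le_trans.
move: (subdifferential_fin fprop xu); case: (f x) => // r _.
rewrite -!EFinB -EFinD lee_fin !ipE (ipC ip x u) (ipC ip x y); lra.
Qed.

Lemma subdifferential_monotone (g : X -> \bar K) x y u v :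
    g x \is a fin_num -> g y \is a fin_num ->
    subdifferential ip g x u -> subdifferential ip g y v ->
  (0 <= ip (x - y) (u - v))%R.
Proof.
move=> gx gy /(_ y) xu /(_ x) yv; move: gx gy xu yv.
case: (g x) => // r; case: (g y) => // s _ _.
rewrite -!EFinD !lee_fin !ipE; lra.
Qed.

(** The converse of [subdifferential_conjugate], i.e. the
    Fenchel-Moreau theorem at points of subdifferentiability: the proximal
    point p of x + u gives a pair (p, x + u - p) in the graph of the
    subdifferential of f, and monotonicity of the subdifferential of f^*
    identifies it with (x, u). *)
Lemma subdifferential_unconjugate f x u : Gamma0 f ->
    edom (conjugate ip f) u -> subdifferential ip (conjugate ip f) u x ->
  subdifferential ip f x u.
Proof.
move=> fG udom ux; have [fprop _ _] := fG.
have [p pdom /(prox_minimizer_subdifferential fG pdom) pv] :=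
  prox_minimizer_ex (x + u)%R fG udom.
set v := (x + u - p)%R in pv.
have vfin : conjugate ip f v \is a fin_num.
  rewrite (conjugate_subdifferential fprop pv).
  by move: (subdifferential_fin fprop pv); case: (f p).
have ufin : conjugate ip f u \is a fin_num.
  by rewrite fin_numElt conjugate_gtNy.
have := subdifferential_monotone vfin ufin
  (subdifferential_conjugate fprop pv) ux.
have -> : (v - u = - (p - x))%R by rewrite /v addrAC addrK opprB.
rewrite ipNl oppr_ge0 => /(ip_le0_eq0 ip_norm)/eqP; rewrite subr_eq0 => /eqP px.
by move: pv; rewrite /v px addrAC subrr add0r.
Qed.

(** f is constant along each line directed by c in C; if <c, u> were nonzero,
    then <., u> - f would be unbounded on that line. *)
Lemma edom_conjugate_orthocomp f (C : set X) u : eproper f ->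
    (forall t x, C x -> C (t *: x)%R) -> translation_invariant f C ->
  edom (conjugate ip f) u -> orthocomp ip C u.
Proof.
move=> fprop CZ finv udom c Cc; apply/eqP/negP => /negP cu0.
have [fNy [x xdom]] := fprop.
have ub t := ip_sub_conjugate f (x + t *: c)%R u.
move: (fNy x) xdom (conjugate_gtNy u fprop) udom ub; rewrite /edom /=.
case fxE : (f x) => [r| |]//; case: (conjugate _ _ _) => [k| |]// _ _ _ _.
(* with this parameter <x + t c, u> - f x equals k + 1, where k = f^*(u) *)
move=> /(_ ((k - ip x u + r + 1) / ip c u)%R).
rewrite finv; last exact: CZ.
rewrite fxE -EFinB lee_fin !ipE divfK//; lra.
Qed.

Lemma subdifferential_translation f (C : set X) x c u :
    translation_invariant f C -> orthocomp ip C u -> C c ->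
  subdifferential ip f x u -> subdifferential ip f (x + c)%R u.
Proof.
move=> finv uC Cc xu y; rewrite finv// opprD addrA ipDl ipNl (uC c)// subr0.
exact: xu.
Qed.

(** Monotonicity of the subdifferential makes the proximal point unique, so
    membership in the set [Prox ip f a] is already equality with a singleton. *)
Lemma Prox_set1P f a p : eproper f ->
  Prox ip f a = [set p] <-> subdifferential ip f p (a - p)%R.
Proof.
move=> fprop; split => [/seteqP[_ /(_ p erefl)[u pu ->]]|pu].
  by rewrite addrAC subrr add0r.
apply/seteqP; split => [q [v qv av]|q ->]; last first.
  by exists (a - p)%R => //; rewrite addrC subrK.
have qfin := subdifferential_fin fprop qv.
have pfin := subdifferential_fin fprop pu.
have := subdifferential_monotone qfin pfin qv pu.
have -> : (v - (a - p) = - (q - p))%R.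
  by rewrite av addrAC opprD addrCA subrr addr0.
rewrite ipNr oppr_ge0 => /(ip_le0_eq0 ip_norm)/eqP; rewrite subr_eq0.
by move=> /eqP.
Qed.

End Subdifferential.

(** * The displacement operator of a linear isometry *)

Section Isometry.
Context {K : realType} {X : completeNormedModType K} (ip : {dot X for idfun}).
Hypothesis ip_norm : induces_norm ip.
Variable R : {linear X -> X}.
Hypothesis R_isom : norm_isometry R.

(** Polarization. *)
Lemma ip_isometry x y : ip (R x) (R y) = ip x y.
Proof.
have sq z : ip (R z) (R z) = ip z z by rewrite !ip_norm R_isom.
have := sq (x + y); rewrite linearD !ipE !sq.
rewrite (ipC ip y x) (ipC ip (R y)); lra.
Qed.

Lemma displB x y : displ R x - displ R y = displ R (x - y).
Proof. by rewrite /displ [R (x - y)]linearB !opprD addrACA. Qed.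

Lemma displ_orthocomp z : orthocomp ip (fixset_of R) (displ R z).
Proof.
by move=> x Rx; rewrite /displ ipDr ipNr -{1}Rx ip_isometry subrr.
Qed.

(** Expand |R z - z|^2 and use |R z| = |z|. *)
Lemma ip_displ z : ip z (displ R z) = - (2^-1 * `|displ R z| ^+ 2).
Proof.
rewrite -ip_norm /displ !ipE ip_isometry (ipC ip (R z)); lra.
Qed.

Lemma fixset_ofZ t x : fixset_of R x -> fixset_of R (t *: x).
Proof. by rewrite /fixset_of /= linearZ /= => ->. Qed.

End Isometry.

Theorem theorem4p8 (K : realType) (X : completeNormedModType K)
    (ip : {dot X for idfun}) (ip_norm : induces_norm ip)
    (m : nat) (m_gt0 : (0 < m)%N)
    (R : {linear X -> X}) (R_isom : norm_isometry R)
    (R_m : forall x, iter m R x = x)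
    (f : X -> \bar K) (f_Gamma0 : Gamma0 f)
    (f_inv : translation_invariant f (fixset_of R))
    (f_dom : orthocomp ip (fixset_of R) `&` edom (conjugate ip f) !=set0)
    (e d : X) (ed_f : is_ed_pair ip m R f e d) (z : X) :
  [<-> Prox ip f (R z) = [set z];
       (conjugate ip f (displ R z) + f z
          + (2^-1 * `|displ R z| ^+ 2)%:E = 0)%E;
       displ R z = d].
Proof.
have [f_proper _ _] := f_Gamma0.
have [_ _ dSe ddom _ d_le0] := ed_f.
have dfin : conjugate ip f d \is a fin_num.
  by rewrite fin_numElt conjugate_gtNy.
have de : subdifferential ip (conjugate ip f) d e.
  move=> y; have [->|ydom] := eqVneq (conjugate ip f y) +oo%E; first exact: leey.
  have yY : orthocomp ip (fixset_of R) y.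
    apply: (edom_conjugate_orthocomp f_proper _ f_inv); first exact: fixset_ofZ.
    by rewrite /edom /= ltey.
  have := d_le0 y yY; rewrite -dSe addeC sube_le0//.
tfae.
- move=> /(Prox_set1P ip_norm _ _ f_proper)/(subdifferentialP ip _ _ f_proper) ->.
  by rewrite ip_displ// -EFinD addNr.
- move=> h.
  have zSz : subdifferential ip f z (displ R z).
    apply/(subdifferentialP ip _ _ f_proper).
    rewrite ip_displ//; move: h; case: (_ + f z)%E => // r.
    by rewrite -EFinD => -[/eqP]; rewrite addr_eq0 => /eqP ->.
  have Szfin : conjugate ip f (displ R z) \is a fin_num.
    rewrite (conjugate_subdifferential f_proper zSz).
    by move: (subdifferential_fin f_proper zSz); case: (f z).
  have := subdifferential_monotone Szfin dfin
    (subdifferential_conjugate f_proper zSz) de.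
  (* the nonnegative quantity is - |S (z - e)|^2 / 2 *)
  rewrite dSe displB ipC ip_displ// -ip_norm oppr_ge0 pmulr_rle0//.
  by move=> /(ip_le0_eq0 ip_norm)/eqP; rewrite -displB subr_eq0 => /eqP.
- move=> Szd; apply/(Prox_set1P ip_norm _ _ f_proper).
  rewrite -/(displ R z) Szd -[z](subrK e) addrC.
  apply: (subdifferential_translation f_inv).
  + by rewrite dSe; exact: displ_orthocomp.
  + have /eqP : displ R (z - e) = 0 by rewrite -displB Szd -dSe subrr.
    by rewrite subr_eq0 => /eqP.
  + exact: subdifferential_unconjugate.
Qed.
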